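(* Let $n \in \mathbb{N}$ with $n \ge 1$ and let $B = (S,D,R,C,M) \in \{0,1\}^n$ be an $n$-bit takum string with $\tau(B) \neq \mathrm{NaR}$, where $\tau$ denotes the takum decoding function. Let $(S,\overline{D},\overline{R},\overline{C},\overline{M})$ be the $n$-bit string obtained from $B$ by inverting all bits except the sign bit $S$ (the most significant bit). Then $$\tau\!\left(\left(S,\overline{D},\overline{R},\overline{C},\overline{M}\right)+1\right) = \begin{cases} \dfrac{1}{\tau(B)} & \text{if } \tau(B) \neq 0,\\ \mathrm{NaR} & \text{if } \tau(B) = 0.\end{cases}$$
   Context: Bit string incrementation. For $B = (B_{n-1},\dots,B_0)\in\{0,1\}^n$ (MSB to LSB) let $\mathrm{UI}(B) := \sum_{i=0}^{n-1} B_i 2^i$. Then $B+1$ is the $n$-bit string with $\mathrm{UI}(B+1) = \mathrm{UI}(B)+1$ if $\mathrm{UI}(B) \le 2^n-2$, and $B+1 := (0,\dots,0)$ if $\mathrm{UI}(B) = 2^n-1$. Takum encoding. Let $n \in \mathbb{N}$ with $n \ge 12$. An $n$-bit string, written from most significant bit (MSB) to least significant bit (LSB), is split as $(S,D,R,C,M) \in \{0,1\}^n$, where: - $S \in \{0,1\}$ is the sign bit (1 bit) and $D \in \{0,1\}$ is the direction bit (1 bit); - $R = (R_2,R_1,R_0) \in \{0,1\}^3$ are the regime bits, and the regime is $r := 7 - (4R_2 + 2R_1 + R_0)$ if $D=0$, and $r := 4R_2+2R_1+R_0$ if $D=1$, so $r \in \{0,\dots,7\}$; - $C = (C_{r-1},\dots,C_0)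 \in \{0,1\}^r$ are the characteristic bits, and the characteristic is $c := -2^{r+1}+1+\sum_{i=0}^{r-1} C_i 2^i$ if $D=0$, and $c := 2^r - 1 + \sum_{i=0}^{r-1} C_i 2^i$ if $D=1$; - $p := n-r-5 \in \{n-12,\dots,n-5\}$ is the mantissa bit count, $M = (M_{p-1},\dots,M_0) \in \{0,1\}^p$ are the mantissa bits, and $m := 2^{-p}\sum_{i=0}^{p-1} M_i 2^i \in [0,1)$ is the mantissa; - $\ell := (-1)^S (c+m)$ is the logarithmic value. The takum value is $\tau((S,D,R,C,M)) := 0$ if $S=0$ and all bits of $D,R,C,M$ are zero; $:= \mathrm{NaR}$ (''not a real'', a special non-real symbol) if $S=1$ and all bits of $D,R,C,M$ are zero; and $:= (-1)^S (\sqrt{\mathrm{e}})^{\ell}$ otherwise, where $\mathrm{e}$ is Euler's number. For $n < 12$, the value of a string is obtained by assuming the missing (least significant) bits to be zero (''ghost bits''), i.e. by appending zero bits on the LSB side until length 12; bit inversion and incrementation are performed on the $n$-bit string itself, before this extension. *)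

(* Defs.v *)
From HB Require Import structures.
From mathcomp Require Import all_boot all_order all_algebra.
From mathcomp Require Import reals sequences exp.

Set Implicit Arguments.
Unset Strict Implicit.
Unset Printing Implicit Defensive.

Import Order.TTheory GRing.Theory Num.Theory.

(* Bit strings are listed from the most significant to the least significant
   bit, whereas [bit s i] is the bit of weight [2 ^ i]. *)
Definition bit (s : bitseq) (i : nat) : bool := nth false (rev s) i.

Definition UI (s : bitseq) : nat := \sum_(i < size s) bit s i * 2 ^ i.

Definition zero_string (n : nat) : n.-tuple bool := [tuple of nseq n false].

(* By [UI_inj] and [UI_incr] below, the [pick] selects the unique string of
   length [n] with the required value, so that its default is never used
   (for [0 < n]). *)
Definition incr (n : nat) (B : n.-tuple bool) : n.-tuple bool :=
  if UI B <= 2 ^ n - 2 then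
    odflt (zero_string n) [pick B' : n.-tuple bool | UI B' == UI B + 1]
  else zero_string n.

Definition invert_but_sign (n : nat) (B : n.-tuple bool) : n.-tuple bool :=
  [tuple if i == 0 :> nat then tnth B i else ~~ tnth B i | i < n].

(* The fields of a string [s] of length at least 12. *)
Definition sign_bit (s : bitseq) : bool := nth false s 0.
Definition direction_bit (s : bitseq) : bool := nth false s 1.
Definition regime_bits (s : bitseq) : bitseq := take 3 (drop 2 s).

Definition regime (s : bitseq) : nat :=
  let k := UI (regime_bits s) in if direction_bit s then k else 7 - k.

Definition characteristic_bits (s : bitseq) : bitseq :=
  take (regime s) (drop 5 s).
Definition mantissa_bits (s : bitseq) : bitseq := drop (regime s + 5) s.
Definition mantissa_bit_count (s : bitseq) : nat := size s - regime s - 5.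

Local Open Scope ring_scope.

Definition characteristic (s : bitseq) : int :=
  let r := regime s in
  if direction_bit s then 2 ^+ r - 1 + (UI (characteristic_bits s))%:Z
  else - 2 ^+ r.+1 + 1 + (UI (characteristic_bits s))%:Z.

Definition mantissa (R : realType) (s : bitseq) : R :=
  2 ^- mantissa_bit_count s * (UI (mantissa_bits s))%:R.

Definition logarithmic_value (R : realType) (s : bitseq) : R :=
  (-1) ^+ sign_bit s * ((characteristic s)%:~R + mantissa R s).

(* A takum value is [Some x] for a real number [x], or else [NaR]. *)
Notation NaR := None (only parsing).

Definition decode (R : realType) (s : bitseq) : option R :=
  if all negb (behead s) then if sign_bit s then NaR else Some 0
  else Some ((-1) ^+ sign_bit s *
             Num.sqrt (expR 1) `^ logarithmic_value R s).

(* The padding is empty when [12 <= n]. *)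
Definition takum (R : realType) (n : nat) (B : n.-tuple bool) : option R :=
  decode R (B ++ nseq (12 - n) false).

Local Close Scope ring_scope.

Lemma UI_cons (b : bool) (s : bitseq) : UI (b :: s) = b * 2 ^ size s + UI s.
Proof.
rewrite /UI /= big_ord_recr /= addnC /bit rev_cons nth_rcons size_rev ltnn eqxx.
by congr (_ + _); apply: eq_bigr => i _; rewrite nth_rcons size_rev ltn_ord.
Qed.

Lemma UI_lt (s : bitseq) : UI s < 2 ^ size s.
Proof.
elim: s => [|b s IHs]; first by rewrite /UI big_ord0.
rewrite UI_cons /= expnS mul2n -addnn.
by case: b; rewrite ?mul1n ?mul0n ?ltn_add2l // (leq_trans IHs) ?leq_addr.
Qed.

Lemma UI_inj (n : nat) : injective (fun B : n.-tuple bool => UI B).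
Proof.
move=> B B' /= eqUI; apply: val_inj => /=.
move: (size_tuple B) (size_tuple B') eqUI.
move: (val B) (val B') => s t {B B'}.
elim: s t n => [|b s IHs] [|c t] [|n] //= [ss] [st].
rewrite !UI_cons ss st => eqUI.
have := UI_lt s; have := UI_lt t; rewrite ss st => ltt lts.
case: b c eqUI => [] []; rewrite ?mul1n ?mul0n ?add0n.
- by move/addnI/(IHs _ _ ss st) => ->.
- by move=> e; move: ltt; rewrite -e ltnNge leq_addr.
- by move=> e; move: lts; rewrite e ltnNge leq_addr.
- by move/(IHs _ _ ss st) => ->.
Qed.

Lemma UI_incr (n : nat) (B : n.-tuple bool) :
  0 < n -> UI B <= 2 ^ n - 2 -> UI (incr B) = UI B + 1.
Proof.
move=> n_gt0 leB; rewrite /incr leB; case: pickP => [B' /eqP //|noB].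
have UIlt (A : n.-tuple bool) : UI A < 2 ^ n by have := UI_lt A; rewrite size_tuple.
pose f (A : n.-tuple bool) : 'I_(2 ^ n) := Ordinal (UIlt A).
have f_inj : injective f by move=> A A' /(congr1 val)/UI_inj.
have ltB : UI B + 1 < 2 ^ n.
  rewrite addn1 -(subnK (_ : 2 <= 2 ^ n)) ?addn2 ?ltnS //.
  by rewrite -{1}(expn1 2) leq_exp2l.
have /codomP[A /(congr1 val) /= eqA] : Ordinal ltB \in codom f.
  by apply: inj_card_onto => //; rewrite card_tuple card_bool card_ord.
by have := noB A; rewrite -eqA eqxx.
Qed.

(* Main.v *)
(* Read the bits after the sign as a natural number [T], let [w] be the number
   of bits after the regime, and write [T = (q + x) * 2 ^ w] with [q < 16] and
   [0 <= x < 1].  Then [c + m] is a function of [q + x] that is affine between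
   consecutive integers, continuous and antisymmetric about [8].  Inverting all
   bits but the sign and adding one replaces [T] by its two's complement, that
   is, [q + x] by [16 - (q + x)], hence negates [c + m]; the only carry into the
   sign bit occurs for [T = 0]. *)
Require Import Defs.
From HB Require Import structures.
From mathcomp Require Import all_boot all_order all_algebra.
From mathcomp Require Import reals sequences exp.
From mathcomp Require Import zify ring lra.

Set Implicit Arguments.
Unset Strict Implicit.

Import Order.TTheory GRing.Theory Num.Theory.

Lemma UI_cat (s t : bitseq) : UI (s ++ t) = UI s * 2 ^ size t + UI t.
Proof.
elim: s => [|b s IHs]; first by rewrite /UI big_ord0.
by rewrite cat_cons !UI_cons size_cat IHs expnD mulnDl addnA mulnA.
Qed.

Lemma UI_nseq0 (k : nat) : UI (nseq k false) = 0.
Proof. by elim: k => [|k IHk] /=; rewrite ?UI_cons ?IHk // /UI big_ord0. Qed.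

Lemma UI_map_negb (s : bitseq) : UI (map negb s) + UI s = 2 ^ size s - 1.
Proof.
elim: s => [|b s IHs]; first by rewrite /UI !big_ord0.
rewrite /= !UI_cons size_map expnS; have := expn_gt0 2 (size s).
by case: b => /=; lia.
Qed.

Lemma UI_eq0 (s : bitseq) : (UI s == 0) = all negb s.
Proof.
elim: s => [|b s IHs]; first by rewrite /UI big_ord0.
rewrite UI_cons addn_eq0 muln_eq0 expn_eq0 orbF IHs /=.
by case: b.
Qed.

(** Uniqueness of quotient and remainder modulo [2 ^ size s]; it shows below that incrementing
    leaves the sign bit alone. *)
Lemma UI_cons_split (b c : bool) (s : bitseq) (k : nat) :
  k < 2 ^ size s -> UI (b :: s) = c * 2 ^ size s + k -> b = c /\ UI s = k.
Proof.
move=> ltk; rewrite UI_cons; have := UI_lt s.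
by case: b c => [] [] /=; lia.
Qed.

Lemma invert_but_signE (n : nat) (b : bool) (s : n.-tuple bool) :
  invert_but_sign [tuple of b :: s] = b :: map negb s :> bitseq.
Proof.
apply: (@eq_from_nth _ false); first by rewrite size_tuple /= size_map size_tuple.
rewrite size_tuple => i ltin.
rewrite -[i]/(nat_of_ord (Ordinal ltin)) -tnth_nth tnth_mktuple (tnth_nth false) /=.
by case: i ltin => [|i] //= ltin; rewrite (nth_map false) ?size_tuple.
Qed.

(** The inverted tail has value [2 ^ n - 1 - UI s], at most [2 ^ n - 2] since [UI s] is positive, so
    adding one causes no carry into the sign bit. *)
Lemma incr_invert_but_sign (n : nat) (b : bool) (s : n.-tuple bool) :
    0 < UI s ->
  exists2 t : n.-tuple bool,
    incr (invert_but_sign [tuple of b :: s]) = b :: t :> bitseq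
    & UI t = 2 ^ n - UI s.
Proof.
move=> s_gt0; set I := invert_but_sign _.
have UI_I : UI I = b * 2 ^ n + UI (map negb s).
  by rewrite /I invert_but_signE UI_cons size_map size_tuple.
have := UI_map_negb s; have := UI_lt s; rewrite size_tuple => lts eqN.
have leI : UI I <= 2 ^ n.+1 - 2 by rewrite UI_I expnS; case: (b); lia.
have := UI_incr (ltn0Sn n) leI; case/tupleP: (incr I) => c t.
rewrite UI_I => eqt.
have [||-> eqUIt] := @UI_cons_split c b t (2 ^ n - UI s).
- by rewrite size_tuple; lia.
- by rewrite size_tuple [LHS]eqt; lia.
by exists t.
Qed.

(** Inversion makes the tail all ones, so the carry runs through it and sets the sign bit. *)
Lemma incr_invert_but_sign0 (n : nat) (s : n.-tuple bool) :
    UI s = 0 ->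
  incr (invert_but_sign [tuple of false :: s]) = true :: nseq n false :> bitseq.
Proof.
move=> s0; set I := invert_but_sign _.
have UI_I : UI I = 2 ^ n - 1.
  have := UI_map_negb s; rewrite s0 size_tuple addn0 => <-.
  by rewrite /I invert_but_signE UI_cons mul0n.
have leI : UI I <= 2 ^ n.+1 - 2 by rewrite UI_I expnS; lia.
suff -> : incr I = [tuple of true :: zero_string n] by [].
apply: UI_inj; rewrite (UI_incr (ltn0Sn n) leI) UI_I UI_cons UI_nseq0.
by rewrite size_tuple addn0 mul1n subnK ?expn_gt0.
Qed.

Local Open Scope ring_scope.

(** This is [c + m] when the direction and regime bits together read [q] and the bits after them
    form the binary fraction [x]; the regime is then [q - 8] or [7 - q]. *)
Definition log_piece (R : realType) (q : nat) (x : R) : R :=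
  if (8 <= q)%N then 2 ^+ (q - 8) * (1 + x) - 1 else 2 ^+ (7 - q) * (x - 2) + 1.

(** The reflection [q -> 15 - q] swaps the two branches and keeps the regime, while [x -> 1 - x]
    turns [1 + x] into [-(x - 2)]. *)
Lemma log_piece_opp (R : realType) (q : nat) (x : R) :
  (q < 16)%N -> log_piece (15 - q) (1 - x) = - log_piece q x.
Proof.
rewrite /log_piece => q_lt; case: (leqP 8 q) => q8.
  have -> : (8 <= 15 - q)%N = false by lia.
  by rewrite (_ : (7 - (15 - q) = q - 8)%N); [ring | lia].
have -> : (8 <= 15 - q)%N by lia.
by rewrite (_ : (15 - q - 8 = 7 - q)%N); [ring | lia].
Qed.

(** Continuity at integers. The slope doubles or halves from one piece to the next, except at the
    centre, where both sides are 0. *)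
Lemma log_piece_glue (R : realType) (q : nat) :
  log_piece q 1 = log_piece q.+1 0 :> R.
Proof.
rewrite /log_piece; case: (ltngtP q 7) => q7.
- have -> : (8 <= q.+1)%N = false by lia.
  by rewrite (_ : (7 - q = (7 - q.+1).+1)%N) ?exprS; [ring | lia].
- have -> : (8 <= q.+1)%N by lia.
  by rewrite (_ : (q.+1 - 8 = (q - 8).+1)%N) ?exprS; [ring | lia].
- by rewrite q7 /= !subnn; ring.
Qed.

Definition log_of_nat (R : realType) (w T : nat) : R :=
  log_piece (T %/ 2 ^ w) ((T %% 2 ^ w)%:R / 2 ^+ w).

Lemma log_of_natD (R : realType) (w q X : nat) :
  (X < 2 ^ w)%N -> log_of_nat R w (q * 2 ^ w + X) = log_piece q (X%:R / 2 ^+ w).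
Proof.
move=> ltX; rewrite /log_of_nat divnMDl ?expn_gt0 // modnMDl.
by rewrite divn_small // modn_small // addn0.
Qed.

Lemma log_of_nat_opp (R : realType) (w T : nat) :
  (0 < T < 2 ^ (4 + w))%N ->
  log_of_nat R w (2 ^ (4 + w) - T) = - log_of_nat R w T.
Proof.
rewrite expnD; set N := (2 ^ w)%N => /andP[T_gt0 T_lt].
have N_gt0 : (0 < N)%N by rewrite expn_gt0.
have N_unit : 2 ^+ w != 0 :> R by rewrite expf_neq0 // pnatr_eq0.
have q_lt : (T %/ N < 16)%N by rewrite ltn_divLR.
have X_lt : (T %% N < N)%N by rewrite ltn_mod.
move: T_gt0 T_lt; rewrite [T](divn_eq T N).
move: (T %/ N)%N (T %% N)%N q_lt X_lt => q X q_lt X_lt T_gt0 T_lt.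
rewrite (log_of_natD R q X_lt) -log_piece_opp //.
(* For [X > 0], [N - X] is a valid remainder. For [X = 0] the reflected fraction would be 1, so it
   is read as fraction 0 of the next piece. *)
have [X0|X_neq0] := eqVneq X 0%N; last first.
  rewrite (_ : (_ - _ = (15 - q) * N + (N - X))%N); last by nia.
  rewrite log_of_natD -/N; last by lia.
  by rewrite natrB ?(ltnW X_lt) // natrX mulrBl divff.
rewrite X0 mul0r subr0 log_piece_glue.
rewrite (_ : (_ - _ = (15 - q).+1 * N + 0)%N); last by nia.
by rewrite log_of_natD -/N // mul0r.
Qed.

Lemma log_of_natE (R : realType) (s : bitseq) : (12 <= size s)%N ->
  (characteristic s)%:~R + mantissa R s = log_of_nat R (size s - 5) (UI (behead s)).
Proof.
case: s => [|S [|D [|r2 [|r1 [|r0 t]]]]] //= size_t.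
have UI_regime : UI [:: r2; r1; r0] = (4 * r2 + 2 * r1 + r0)%N.
  by rewrite !UI_cons /UI big_ord0; case: r2 r1 r0 => [] [] [].
have UI_tail : UI [:: D, r2, r1, r0 & t]
    = ((8 * D + 4 * r2 + 2 * r1 + r0) * 2 ^ size t + UI t)%N.
  rewrite (UI_cat [:: D; r2; r1; r0]) (UI_cons D) UI_regime /=.
  by rewrite (mulnC D) !addnA.
set q := (4 * r2 + 2 * r1 + r0)%N in UI_regime.
rewrite UI_tail (_ : (_ - 5 = size t)%N); last by lia.
rewrite log_of_natD ?UI_lt //.
rewrite (_ : (8 * D + _ + _ + _ = 8 * D + q)%N); last by rewrite /q; lia.
set s := [:: S, D, r2, r1, r0 & t]; pose r := regime s.
have rE : r = if D then q else (7 - q)%N.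
  by rewrite /r /regime /regime_bits /= take0 UI_regime.
have q_le : (q <= 7)%N by rewrite /q; case: (r2) (r1) (r0) => [] [] [].
(* At least 7 bits follow the regime bits and [r <= 7], so [C] is not truncated. *)
have r_le : (r <= size t)%N by rewrite rE; case: (D); lia.
have Csize : size (drop r t) = (size t - r)%N by rewrite size_drop.
have pE : mantissa_bit_count s = (size t - r)%N.
  by rewrite /mantissa_bit_count -/r /=; lia.
have ME : mantissa_bits s = drop r t.
  by rewrite /mantissa_bits -/r addnC.
have CE : characteristic_bits s = take r t.
  by rewrite /characteristic_bits -/r /= drop0.
have pow_unit k : 2 ^+ k != 0 :> R by rewrite expf_neq0 // pnatr_eq0.
(* Concatenating [C] and [M] turns [C + m] into a single dyadic fraction. *)
have CM : (UI (take r t))%:R + mantissa R s = 2 ^+ r * ((UI t)%:R / 2 ^+ size t).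
  rewrite /mantissa pE ME -[in UI t](cat_take_drop r t) UI_cat Csize.
  rewrite -[in X in _ / X](subnKC r_le) exprD natrD natrM natrX.
  by field; rewrite !pow_unit.
rewrite /characteristic -/r CE /log_piece (_ : direction_bit s = D) //.
case: (D) rE => rE.
  have -> : (8 <= 8 * true + q)%N by lia.
  rewrite rmorphD rmorphB rmorphXn /= -addrA CM rE (_ : (_ - 8 = q)%N); last by lia.
  ring.
have -> : (8 <= 8 * false + q)%N = false by lia.
rewrite rmorphD rmorphD rmorphN rmorphXn /= -addrA CM muln0 add0n rE exprS; ring.
Qed.

Definition decode_nat (R : realType) (w : nat) (b : bool) (T : nat) : option R :=
  if T == 0%N then if b then None else Some 0
  else Some ((-1) ^+ b * Num.sqrt (expR 1) `^ ((-1) ^+ b * log_of_nat R w T)).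

Lemma decode_natE (R : realType) (b : bool) (s : bitseq) : (11 <= size s)%N ->
  decode R (b :: s) = decode_nat R (size s - 4) b (UI s).
Proof.
move=> size_s; rewrite /decode /decode_nat UI_eq0 /=; case: ifP => // _.
by rewrite /logarithmic_value log_of_natE.
Qed.

(** The [11 - n] ghost bits scale the value of the tail by a power of two; the truncated subtraction
    makes this factor 1 for long strings. *)
Lemma takum_consE (R : realType) (n : nat) (B : n.+1.-tuple bool) (b : bool)
    (s : n.-tuple bool) : B = b :: s :> bitseq ->
  takum R B = decode_nat R (n + (11 - n) - 4) b (UI s * 2 ^ (11 - n)).
Proof.
move=> eqB; rewrite /takum eqB cat_cons subSS decode_natE.
  by rewrite UI_cat UI_nseq0 size_cat size_nseq size_tuple addn0.
by rewrite size_cat size_nseq size_tuple; lia.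
Qed.

Theorem proposition7 (R : realType) (n : nat) (n_ge1 : (1 <= n)%N)
    (B : n.-tuple bool) (B_not_NaR : takum R B <> NaR) :
  takum R (incr (invert_but_sign B)) =
    if takum R B != Some 0 then omap (fun x : R => 1 / x) (takum R B) else NaR.
Proof.
case: n n_ge1 B B_not_NaR => // n _ B; case/tupleP: B => b s.
rewrite (@takum_consE R n _ b s) //; set w := (_ - 4)%N; set k := (11 - n)%N.
have [s0|s_neq0] := eqVneq (UI s) 0%N.
  (* A zero tail with sign bit 1 is excluded, being NaR. *)
  rewrite s0 mul0n /decode_nat eqxx; case: b => // _.
  rewrite eqxx /= (takum_consE R (incr_invert_but_sign0 s0 : _ = true :: zero_string n)).
  by rewrite UI_nseq0 mul0n.
move=> _; have s_gt0 : (0 < UI s)%N by rewrite lt0n.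
have [t eqt UIt] := incr_invert_but_sign b s_gt0.
rewrite (takum_consE R eqt) -/w -/k UIt.
have s_lt : (UI s < 2 ^ n)%N by have := UI_lt s; rewrite size_tuple.
have T_gt0 : (0 < UI s * 2 ^ k)%N by rewrite muln_gt0 s_gt0 expn_gt0.
have T_lt : (UI s * 2 ^ k < 2 ^ (4 + w))%N.
  rewrite (_ : (4 + w = n + k)%N); last by rewrite /w /k; lia.
  by rewrite expnD ltn_pmul2r ?expn_gt0.
(* Two's complement on [n] bits followed by padding equals two's complement on the padded tail of
   [4 + w] bits. *)
rewrite mulnBl -expnD (_ : (n + k = 4 + w)%N); last by rewrite /w /k; lia.
rewrite /decode_nat -[(_ == 0)%N]negbK -lt0n subn_gt0 T_lt /=.
rewrite -[(UI s * _ == 0)%N]negbK -lt0n T_gt0 /=.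
have pow_gt0 x : 0 < Num.sqrt (expR 1) `^ x :> R.
  by rewrite powR_gt0 // sqrtr_gt0 expR_gt0.
rewrite ifT; last first.
  by apply/eqP => -[] /eqP; rewrite mulf_eq0 signr_eq0 gt_eqF.
(* Negating the exponent inverts the power, and the sign is its own inverse. *)
by rewrite log_of_nat_opp ?T_gt0 // mulrN powRN div1r invfM invr_sign.
Qed.
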